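(* Let $R$ be a ring and let $E(R)$ be the injective hull of $R$ as a right $R$-module. (1) If $E(R)$ is retractable and $R$ is right Kasch, then $R$ is right dual Kasch. (2) If $E(R)$ is coretractable and $R$ is right dual Kasch, then $R$ is right Kasch.
   Context: Rings are associative, unital and non-trivial; modules are unital right modules. A ring $R$ is right Kasch if every simple right $R$-module embeds into $R$, and right dual Kasch if every simple right $R$-module is isomorphic to a factor module of an injective right $R$-module. A right module $M$ is retractable if $\mathrm{Hom}(M,K)\neq 0$ for every non-zero submodule $K$ of $M$, and coretractable if $\mathrm{Hom}(M/K,M)\neq 0$ for every proper submodule $K$ of $M$. *)

(* Defs.v *)
From HB Require Import structures.
From mathcomp Require Import all_boot all_algebra.

Set Implicit Arguments.
Unset Strict Implicit.
Unset Printing Implicit Defensive.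

Import GRing.Theory.
Local Open Scope ring_scope.
Local Open Scope quotient_scope.

(* Right R-modules are left modules over the converse ring R^c: the right     *)
(* action v . a is written a *: v, and a * b in R^c is b * a in R, so that    *)
(* the left-module axiom a *: (b *: v) = (a * b) *: v of lmodType R^c says    *)
(* (v . b) . a = v . (b a).                                                   *)
Notation rmodType R := (lmodType R^c).

(* R as a right module over itself: in (R^c)^o, a *: x is x * a in R. *)
Notation rregular R := (R^c)^o.

(* Submodules of M are the inhabitants of submodClosed M. Membership there is *)
(* boolean, which loses no submodule under the classical axioms of boolp      *)
(* (every Prop is reflected by a bool).                                       *)
Section Submodule.
Variables (R : pzRingType) (M : lmodType R) (K : submodClosed M).

Inductive submodule := Submodule (x : M) of x \in K.
Definition submodule_val (u : submodule) := let: Submodule x _ := u in x.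

HB.instance Definition _ := [isSub for submodule_val].
HB.instance Definition _ := [Choice of submodule by <:].
HB.instance Definition _ := [SubChoice_isSubLmodule of submodule by <:].

End Submodule.

(* M / K: the additive quotient of ring_quotient with the induced scaling. *)
Section FactorModule.
Variables (R : pzRingType) (M : lmodType R) (K : submodClosed M).

Fact submod_oppr_closed : oppr_closed (K : {pred M}).
Proof. by move=> x Kx; rewrite -scaleN1r rpredZ. Qed.

Definition zmod_of_submod : {pred M} := K.
HB.instance Definition _ := GRing.AddClosed.on zmod_of_submod.
HB.instance Definition _ :=
  GRing.isOppClosed.Build M zmod_of_submod submod_oppr_closed.

Definition factor_module := Quotient.quot zmod_of_submod.

HB.instance Definition _ := GRing.Zmodule.on factor_module.
HB.instance Definition _ := EqQuotient.on factor_module.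

Definition factor_scale (a : R) := lift_op1 factor_module ( *:%R a).

Fact factor_piE x y : (\pi_factor_module x = \pi_factor_module y) <-> x - y \in K.
Proof.
split=> [/eqP | Kxy]; first by rewrite -Quotient.idealrBE.
by apply/eqP; rewrite -Quotient.idealrBE.
Qed.

Fact factor_piD x y :
  \pi_factor_module (x + y) = \pi_factor_module x + \pi_factor_module y.
Proof. exact: (@Quotient.pi_add M zmod_of_submod). Qed.

Fact factor_piZ a x :
  \pi_factor_module (a *: x) = factor_scale a (\pi_factor_module x).
Proof.
unlock factor_scale; apply/factor_piE; rewrite -scalerBr rpredZ //.
by apply/factor_piE; rewrite reprK.
Qed.

Fact factor_scaleA a b u :
  factor_scale a (factor_scale b u) = factor_scale (a * b) u.
Proof. by elim/quotW: u => x; rewrite -!factor_piZ scalerA. Qed.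

Fact factor_scale1 : left_id 1 factor_scale.
Proof. by elim/quotW => x; rewrite -factor_piZ scale1r. Qed.

Fact factor_scaleDr : right_distributive factor_scale +%R.
Proof.
move=> a; elim/quotW=> x; elim/quotW=> y.
by rewrite -factor_piD -!factor_piZ scalerDr factor_piD.
Qed.

Fact factor_scaleDl u : {morph factor_scale^~ u : a b / a + b}.
Proof.
by elim/quotW: u => x a b; rewrite /= -!factor_piZ scalerDl factor_piD.
Qed.

HB.instance Definition _ := GRing.Zmodule_isLmodule.Build R factor_module
  factor_scaleA factor_scale1 factor_scaleDr factor_scaleDl.

End FactorModule.

Section ModuleNotions.
Variable R : pzRingType.
Implicit Types M N E S : lmodType R.

Definition nonzero_submod M (K : submodClosed M) : Prop :=
  exists2 x : M, x \in K & x != 0.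

Definition proper_submod M (K : submodClosed M) : Prop :=
  exists x : M, x \notin K.

Definition simple_module S : Prop :=
  (exists x : S, x != 0) /\
  forall K : submodClosed S, nonzero_submod K -> ~ proper_submod K.

Definition embeds M N : Prop := exists f : {linear M -> N}, injective f.

Definition isomorphic M N : Prop := exists f : {linear M -> N}, bijective f.

Definition nonzero_Hom M N : Prop :=
  exists f : {linear M -> N}, exists x : M, f x != 0.

Definition injective_module M : Prop :=
  forall (A B : lmodType R) (i : {linear A -> B}) (f : {linear A -> M}),
    injective i -> exists g : {linear B -> M}, forall x : A, g (i x) = f x.

Definition essential_embedding M N (i : {linear M -> N}) : Prop :=
  injective i /\
  forall K : submodClosed N, nonzero_submod K ->
    exists2 x : M, i x \in K & i x != 0.

Definition is_injective_hull M E (i : {linear M -> E}) : Prop :=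
  injective_module E /\ essential_embedding i.

Definition retractable M : Prop :=
  forall K : submodClosed M, nonzero_submod K -> nonzero_Hom M (submodule K).

Definition coretractable M : Prop :=
  forall K : submodClosed M, proper_submod K -> nonzero_Hom (factor_module K) M.

End ModuleNotions.

Definition right_Kasch (R : nzRingType) : Prop :=
  forall S : rmodType R, simple_module S -> embeds S (rregular R).

Definition right_dual_Kasch (R : nzRingType) : Prop :=
  forall S : rmodType R, simple_module S ->
    exists M : rmodType R, injective_module M /\
      exists K : submodClosed M, isomorphic S (factor_module K).

(* Main.v *)
Require Import Defs.
From HB Require Import structures.
From mathcomp Require Import all_boot all_algebra.
From mathcomp Require Import boolp.

(** Both parts transport a simple module [S] along a chain of non-zero maps,
    using that a non-zero map out of a simple module is injective and a
    non-zero map into one is surjective (Schur).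

    For (1), a Kasch ring embeds [S] into [R], hence into [E].  Retractability
    of [E] applied to the copy of [S] inside [E] yields a non-zero map
    [E -> S]; it is surjective, so [S] is a factor of the injective module [E].

    For (2), write [S] as a factor [M / K] of an injective module [M].  A
    surjection [M -> S] is non-zero at some [m]; the map [R -> M] sending 1 to
    [m] extends along [i : R -> E] to [E -> M] because [M] is injective, and
    the composite [E -> M -> S] is still non-zero.  So [S] is also a factor of
    [E], and coretractability of [E] gives a non-zero, hence injective, map
    [S -> E].  Its image meets [R] by essentiality; since [S] is generated by
    any of its non-zero elements, the whole image lies in [R].

    The recurring tool is [factor_through_inj]: a linear map whose values all
    lie in the image of an injective linear map factors linearly through it. *)

Set Implicit Arguments.
Unset Strict Implicit.
Unset Printing Implicit Defensive.

Import GRing.Theory.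
Local Open Scope ring_scope.
Local Open Scope quotient_scope.

Section LinearMaps.
Variable R : pzRingType.
Implicit Types M N P S L E : lmodType R.

Section KernelImage.
Variables (M N : lmodType R) (f : {linear M -> N}).

Definition ker_submod : {pred M} := [pred x | f x == 0].

Fact ker_submod_closed : GRing.submod_closed ker_submod.
Proof.
split=> [|a x y]; rewrite !inE ?linear0 // linearP => /eqP-> /eqP->.
by rewrite scaler0 addr0.
Qed.

HB.instance Definition _ :=
  GRing.isSubmodClosed.Build R M ker_submod ker_submod_closed.

Definition im_submod : {pred N} := [pred y | `[< exists x, f x = y >]].

Lemma im_submodP y : reflect (exists x, f x = y) (y \in im_submod).
Proof. exact: asboolP. Qed.

Fact im_submod_closed : GRing.submod_closed im_submod.
Proof.
split=> [|a _ _ /im_submodP[x <-] /im_submodP[y <-]]; apply/im_submodP.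
  by exists 0; rewrite linear0.
by exists (a *: x + y); rewrite linearP.
Qed.

HB.instance Definition _ :=
  GRing.isSubmodClosed.Build R N im_submod im_submod_closed.

End KernelImage.

(** Preimages under [j] are unique, so whichever one is chosen for each [f x],
    the choice depends linearly on [x]. *)
Lemma factor_through_inj M N P (j : {linear N -> P}) (f : {linear M -> P}) :
    injective j -> (forall x, exists y, j y = f x) ->
  exists g : {linear M -> N}, forall x, j (g x) = f x.
Proof.
move=> inj_j f_im.
have f_imb x : exists y, j y == f x by have [y jy] := f_im x; exists y; apply/eqP.
pose g x := xchoose (f_imb x).
have jg x : j (g x) = f x by apply/eqP/(xchooseP (f_imb x)).
have g_lin : linear g by move=> a x y; apply: inj_j; rewrite linearP !jg linearP.
by exists (HB.pack_for {linear M -> N} g (GRing.isLinear.Build R M N *:%R g g_lin)).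
Qed.

Lemma pi_linear M (K : submodClosed M) : linear \pi_(factor_module K).
Proof. by move=> a x y; rewrite factor_piD factor_piZ. Qed.

Lemma first_isomorphism M N (f : {linear M -> N}) :
  (forall y, exists x, f x = y) -> isomorphic N (factor_module (ker_submod f)).
Proof.
move=> surj_f; pose Q := factor_module (ker_submod f).
pose h (u : Q) := f (repr u).
have h_pi x : h (\pi_Q x) = f x.
  apply/eqP; rewrite -subr_eq0 -linearB.
  by have /factor_piE := reprK (\pi_Q x); rewrite inE.
have h_lin : linear h.
  move=> a; elim/quotW=> x; elim/quotW=> y.
  by rewrite -pi_linear !h_pi linearP.
have inj_h : injective h.
  elim/quotW=> x; elim/quotW=> y; rewrite !h_pi => fxy.
  by apply/factor_piE; rewrite inE linearB fxy subrr.
pose hL : {linear Q -> N} := HB.pack_for {linear Q -> N} h (GRing.isLinear.Build R Q N *:%R h h_lin).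
have [y|g gK] := @factor_through_inj N Q N hL idfun inj_h.
  by have [x fx] := surj_f y; exists (\pi_Q x); rewrite [LHS]h_pi.
by exists g, hL => // u; apply: inj_h; rewrite [LHS]gK.
Qed.

Section Orbit.
Variables (M : lmodType R) (v : M).

Definition orbit_map (a : R^o) : M := (a : R) *: v.

Fact orbit_map_linear : linear orbit_map.
Proof. by move=> a b c; rewrite /orbit_map scalerDl scalerA. Qed.

HB.instance Definition _ :=
  GRing.isLinear.Build R R^o M *:%R orbit_map orbit_map_linear.

End Orbit.

Lemma simple_map_inj S N (f : {linear S -> N}) :
  simple_module S -> (exists x, f x != 0) -> injective f.
Proof.
move=> [_ simS] [x fx_neq0]; apply: raddf_inj => y fy0.
apply/eqP/negP => /negP y_neq0.
apply: (simS (ker_submod f)); first by exists y; rewrite // inE fy0.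
by exists x; rewrite inE.
Qed.

Lemma simple_map_surj M S (f : {linear M -> S}) :
  simple_module S -> (exists x, f x != 0) -> forall y, exists x, f x = y.
Proof.
move=> [_ simS] [x fx_neq0] y; apply/im_submodP.
apply/negP => /negP y_notin; apply: (simS (im_submod f)); last by exists y.
by exists (f x) => //; apply/im_submodP; exists x.
Qed.

(** The copy of [S] in [E] is a non-zero submodule; retractability maps [E]
    non-trivially into it, and pulling back along the embedding lands in [S]. *)
Lemma retractable_simple_factor S E :
    simple_module S -> retractable E -> embeds S E ->
  exists K : submodClosed E, isomorphic S (factor_module K).
Proof.
move=> simS retE [f inj_f]; have [[s s_neq0] _] := simS.
have [|g [x gx_neq0]] := retE (im_submod f).
  exists (f s); first by apply/im_submodP; exists s.
  by rewrite raddf_eq0.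
have [z|h fh] := @factor_through_inj E S E f (val \o g) inj_f.
  exact/im_submodP/(valP (g z)).
eexists; apply: (@first_isomorphism _ _ h); apply: simple_map_surj => //.
exists x; apply: contraNneq gx_neq0 => hx0; apply/eqP/val_inj.
by rewrite raddf0 -[LHS]fh hx0 linear0.
Qed.

Lemma coretractable_simple_embeds S E (f : {linear E -> S}) :
  simple_module S -> coretractable E -> (exists x, f x != 0) -> embeds S E.
Proof.
move=> simS corE f_neq0; have [x fx_neq0] := f_neq0.
have [|h [u hu_neq0]] := corE (ker_submod f); first by exists x; rewrite inE.
have [g [g' gK g'K]] := first_isomorphism (simple_map_surj simS f_neq0).
exists (h \o g); apply: simple_map_inj => //.
by exists (g' u); rewrite /= g'K.
Qed.

(** Injectivity of [M] extends [1 |-> m] from [R] to [E], and the extension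
    takes the value [m] at [i 1], where composing with [p] gives [p m]. *)
Lemma extend_nonzero M N E (i : {linear R^o -> E}) (p : {linear M -> N}) :
    injective i -> injective_module M -> (exists m, p m != 0) ->
  exists f : {linear E -> N}, exists x, f x != 0.
Proof.
move=> inj_i injM [m pm_neq0].
have [g gi] := injM _ _ i (orbit_map m) inj_i.
by exists (p \o g), (i 1); rewrite /= gi /= /orbit_map scale1r.
Qed.

(** Essentiality gives one non-zero element of the copy of [S] inside [L]; as
    this element generates [S], the whole copy lies in [L]. *)
Lemma simple_embeds_essential S L E (i : {linear L -> E}) :
  simple_module S -> essential_embedding i -> embeds S E -> embeds S L.
Proof.
move=> simS [inj_i ess_i] [g inj_g]; have [[s s_neq0] _] := simS.
have [|x /im_submodP[t gt] ix_neq0] := ess_i (im_submod g).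
  exists (g s); first by apply/im_submodP; exists s.
  by rewrite raddf_eq0.
have t_neq0 : t != 0.
  by apply: contraNneq ix_neq0 => t0; rewrite -gt t0 linear0.
have [y|h ih] := @factor_through_inj S L E i g inj_i.
  have [|a <-] := @simple_map_surj R^o S (orbit_map t) simS _ y.
    by exists 1; rewrite /= /orbit_map scale1r.
  by exists ((a : R) *: x); rewrite /= /orbit_map !linearZ /= gt.
by exists h => y z hyz; apply: inj_g; rewrite -!ih hyz.
Qed.

End LinearMaps.

Theorem proposition2p4 (R : nzRingType) (E : rmodType R)
    (i : {linear (rregular R) -> E}) (hE : is_injective_hull i) :
  (retractable E -> right_Kasch R -> right_dual_Kasch R) /\
  (coretractable E -> right_dual_Kasch R -> right_Kasch R).
Proof.
have [injE ess_i] := hE; have [inj_i _] := ess_i.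
split=> [retE kaschR|corE dualR] S simS.
  exists E; split=> //; apply: retractable_simple_factor => //.
  have [f inj_f] := kaschR S simS.
  by exists (i \o f); apply: inj_comp.
have [M [injM [K [g [g' gK g'K]]]]] := dualR S simS.
have [[s s_neq0] _] := simS.
(* The projection M -> M / K, transported to a map M -> S. *)
pose pi := \pi_(factor_module K).
pose piL : {linear M -> factor_module K} :=
  HB.pack_for {linear M -> factor_module K} pi
    (GRing.isLinear.Build _ M _ *:%R pi (@pi_linear _ M K)).
have [m|p gp] := @factor_through_inj _ M S _ g piL (can_inj gK).
  by exists (g' (pi m)); rewrite g'K.
have p_neq0 : exists m, p m != 0.
  exists (repr (g s)); suff -> : p (repr (g s)) = s by [].
  by apply: (can_inj gK); rewrite gp [LHS]reprK.
have [f f_neq0] := extend_nonzero inj_i injM p_neq0.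
apply: simple_embeds_essential (simS) ess_i _.
exact: coretractable_simple_embeds simS corE f_neq0.
Qed.
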